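(* Let $(G=(V,E),L,c,r,e_r)$ be a rooted WRAP instance, $S\subseteq L$ a WRAP solution, and $\vec F_0\subseteq\mathrm{Shadows}(L)$ a non-shortenable directed WRAP solution. Then for every $\varepsilon>0$ there exist a partition $\mathcal K$ of $S$ into $4\lceil 1/\varepsilon\rceil$-thin sets and a set $\vec R\subseteq\vec F_0$ such that (1) for every $\vec\ell\in\vec F_0\setminus\vec R$ there is some $K\in\mathcal K$ with $\vec\ell\in\mathrm{Drop}_{\vec F_0}(K)$, and (2) $c(\vec R)\le\varepsilon\cdot c(\vec F_0)$.
   Context: Rooted WRAP instance: cycle $G=(V,E)$, links $L\subseteq\binom V2$, costs $c\colon L\to\mathbb R_{\ge0}$, root $r$, edge $e_r\in E$ at $r$. $\mathcal C_G=\{C\subseteq V\setminus\{r\}:|\delta_E(C)|=2\}$; $\delta_F(U)$ = elements of $F$ with exactly one endpoint in $U$. A WRAP solution is $S\subseteq L$ with $\delta_S(C)\ne\emptyset$ for all $C\in\mathcal C_G$. Directed link $(u,v)$ covers $C$ if $v\in C,u\notin C$; a directed WRAP solution covers all $C\in\mathcal C_G$. Shortening of $(u,v)$: $(s,v)$, $s\ne v$, $s$ on the $u$-$v$ path of $(V,E\setminus\{e_r\})$ (strict if $s\ne u$); shadows of $\{u,v\}$: shortenings of $(u,v)$ or $(v,u)$; a shadow of $\ell$ carries cost $c(\ell)$ and $c$ of a set is the sum. Non-shortenable: deleting or strictly shortening any link destroys feasibility; then $(V,\vec F_0)$ is an $r$-arborescence. $(u,v)\in\vec F_0$ is responsible for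 $C\in\mathcal C_G$ if it covers $C$ and no link on the $r$-$u$ path in $(V,\vec F_0)$ covers $C$. $\mathrm{Drop}_{\vec F_0}(K)$: links $\vec\ell\in\vec F_0$ such that every $C$ for which $\vec\ell$ is responsible satisfies $\delta_K(C)\ne\emptyset$. For $\alpha\in\mathbb Z_{>0}$, $K\subseteq L$ is $\alpha$-thin if there is an inclusion-wise maximal laminar family $\mathcal L\subseteq\mathcal C_G$ (any two members disjoint or nested) with $|\delta_K(C)|\le\alpha$ for all $C\in\mathcal L$. *)

(* Defs.v *)
From mathcomp Require Import all_boot all_order all_algebra.
From mathcomp Require Import reals.

Set Implicit Arguments.
Unset Strict Implicit.
Unset Printing Implicit Defensive.

Import Order.TTheory GRing.Theory Num.Theory.

(* Edges are abstract objects with a set of endpoints, so that the cycle on two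
   vertices (two parallel edges) is allowed. *)
Definition is_cycle (V E : finType) (ends : E -> {set V}) : Prop :=
  exists (n : nat) (v : 'I_n -> V) (e : 'I_n -> E),
    [/\ 1 < n, bijective v, bijective e &
        forall i : 'I_n, ends (e i) = [set v i; v (ordS i)]].

(* A link is a two-element set of vertices; [cost] is only meaningful on
   [links]. *)
Record rootedWRAP (R : realType) (V E : finType) := RootedWRAP {
  ends : E -> {set V};
  links : {set {set V}};
  cost : {set V} -> R;
  root : V;
  root_edge : E;
  ends_cycle : is_cycle ends;
  links_card2 : forall l, l \in links -> #|l| = 2;
  cost_ge0 : forall l, l \in links -> (0 <= cost l)%R;
  root_edgeP : root \in ends root_edge
}.

Definition delta (V T : finType) (endpts : T -> {set V}) (F : {set T})
    (U : {set V}) : {set T} :=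
  [set x in F | #|endpts x :&: U| == 1].

Definition delta_links (V : finType) (F : {set {set V}}) (U : {set V}) :=
  delta id F U.

(* The same pair (u, v) may be a shadow of several links of different costs,
   so a directed link (l, (u, v)) records the link l it is a shadow of, which
   determines its cost. *)
Definition dlink (V : finType) : finType := ({set V} * (V * V))%type.

Definition origin (V : finType) (f : dlink V) : {set V} := f.1.
Definition tail (V : finType) (f : dlink V) : V := f.2.1.
Definition head (V : finType) (f : dlink V) : V := f.2.2.

Definition covers (V : finType) (f : dlink V) (C : {set V}) : bool :=
  (head f \in C) && (tail f \notin C).

(* [map tail p = belast x (map head p)] says that the links of p chain up
   starting from x. *)
Definition is_dipath (V : finType) (F : {set dlink V}) (x y : V)
    (p : seq (dlink V)) : Prop :=
  [/\ {subset p <= F},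
      map (@tail V) p = belast x (map (@head V) p),
      last x (map (@head V) p) = y &
      uniq (x :: map (@head V) p)].

Definition laminar (V : finType) (F : {set {set V}}) : bool :=
  [forall A in F, forall B in F,
     [|| [disjoint A & B], A \subset B | B \subset A]].

Section Instance.
Variables (R : realType) (V E : finType) (I : rootedWRAP R V E).

Definition cuts : {set {set V}} :=
  [set C : {set V} | (root I \notin C) && (#|delta (ends I) setT C| == 2)].

Definition is_solution (S : {set {set V}}) : Prop :=
  S \subset links I /\ forall C, C \in cuts -> delta_links S C != set0.

Definition is_directed_solution (F : {set dlink V}) : Prop :=
  forall C, C \in cuts -> exists2 f, f \in F & covers f C.

Definition adj_minus_root_edge : rel V :=
  fun x y => [exists e, (e != root_edge I) && (ends I e == [set x; y])].

Definition on_path (u v s : V) : Prop :=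
  exists p : seq V, [/\ path adj_minus_root_edge u p, last u p = v,
                        uniq (u :: p) & s \in u :: p].

Definition shortening (u v s : V) : Prop := s != v /\ on_path u v s.

Definition is_shadow (f : dlink V) : Prop :=
  origin f \in links I /\
  exists2 u : V, origin f = [set u; head f] & shortening u (head f) (tail f).

Definition non_shortenable (F : {set dlink V}) : Prop :=
  (forall f, f \in F -> ~ is_directed_solution (F :\ f)) /\
  (forall f s, f \in F -> shortening (tail f) (head f) s -> s != tail f ->
     ~ is_directed_solution ((origin f, (s, head f)) |: (F :\ f))).

(* For a non-shortenable directed solution F, (V, F) is an arborescence, hence
   the dipath below exists and is unique. *)
Definition responsible (F : {set dlink V}) (f : dlink V) (C : {set V}) : Prop :=
  [/\ C \in cuts, covers f C &
      exists2 p, is_dipath F (root I) (tail f) p &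
                 forall g, g \in p -> ~~ covers g C].

Definition Drop (F : {set dlink V}) (K : {set {set V}}) (f : dlink V) : Prop :=
  f \in F /\ forall C, responsible F f C -> delta_links K C != set0.

Definition thin (alpha : nat) (K : {set {set V}}) : Prop :=
  K \subset links I /\
  exists2 F : {set {set V}},
    maxset (fun F' => laminar F' && (F' \subset cuts)) F &
    forall C, C \in F -> #|delta_links K C| <= alpha.

Definition dcost (F : {set dlink V}) : R := (\sum_(f in F) cost I (origin f))%R.

End Instance.

(* Main.v *)
From mathcomp Require Import all_boot all_order all_algebra.
From mathcomp Require Import reals.
From mathcomp Require Import boolp zify ring.
Require Import Defs.

Set Implicit Arguments.
Unset Strict Implicit.
Unset Printing Implicit Defensive.

Import Order.TTheory GRing.Theory Num.Theory.

(** Number the vertices [0 .. N] along the path obtained by deleting the root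
   edge, with the root at [0]: cuts become the intervals of [1 .. N].

   Territories.  Non-shortenability gives each [f] in [F0] a cut that only [f]
   enters and that starts next to the tail of [f].  Let [D v] be the largest
   cut around [v] entered only at [v] (the descendants of [v]).  Every interval
   [C] has a unique top, a vertex [v] of [C] with [C \subset D v], and the link
   responsible for [C] is the one with head [v].

   Festoons.  Split [S] greedily: a block is a minimal subfamily of the
   remaining links whose intervals cover a longest interval covered by the
   remaining links.  At most two links of a block pass over a gap, hence at
   most four cover a cut, and the hulls of the blocks are laminar.

   Dependency.  Let [v] be the top of the hull of a block [r].  Among the blocks
   chosen before [r] with an endpoint in that hull, [r] points to the smallest
   that leaves [D v], or to the largest if none leaves [D v].  Following the
   pointers from a block at [v] until [D v] is left yields blocks covering all
   the cuts with top [v].  Let [lam r] count the territories left on the way from [r].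
   Cutting the pointers of the blocks with [lam] in a fixed class modulo
   [k = ceil (1 / eps)] sacrifices the heads [v] labelled by that class, one
   class having cost at most [c(F0) / k].  If a cut is laminar with all hulls,
   the blocks of one class that cover it are pairwise tangled, and [lam] takes
   distinct values on all of them but the last, in a window of length [k - 1];
   so there are at most [k] of them, which contribute at most [4 k] links. *)

(** * Territories *)

Lemma nat_max_exists (P : nat -> Prop) (M m0 : nat) :
  P m0 -> (forall m, P m -> m <= M) ->
  exists m, P m /\ forall m', P m' -> m' <= m.
Proof.
move=> Pm0 PM; have exP : exists m, `[< P m >] by exists m0; apply/asboolP.
have bdP m : `[< P m >] -> m <= M by move/asboolP/PM.
case: (ex_maxnP exP bdP) => m /asboolP Pm mmax; exists m; split=> // m' Pm'.
exact/mmax/asboolP.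
Qed.

Lemma nat_min_exists (P : nat -> Prop) (m0 : nat) :
  P m0 -> exists m, P m /\ forall m', P m' -> m <= m'.
Proof.
move=> Pm0; have exP : exists m, `[< P m >] by exists m0; apply/asboolP.
case: (ex_minnP exP) => m /asboolP Pm mmin; exists m; split=> // m' Pm'.
exact/mmin/asboolP.
Qed.

Definition enters (A : Type) (t h : A -> nat) (f : A) (i j : nat) : Prop :=
  i <= h f <= j /\ ~ (i <= t f <= j).

Section Territories.
Variables (A : finType) (F : {set A}) (t h : A -> nat) (N : nat).
Hypothesis tail_le : forall f, f \in F -> t f <= N.
Hypothesis cut_entered : forall i j, 0 < i -> i <= j -> j <= N ->
  exists2 f, f \in F & enters t h f i j.
Hypothesis private_cut : forall f, f \in F -> exists i j,
  [/\ 0 < i, i <= h f <= j, j <= N, (t f).+1 = i \/ t f = j.+1 &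
      forall g, g \in F -> enters t h g i j -> g = f].

Definition rooted (v i j : nat) : Prop :=
  [/\ 0 < i, i <= v <= j, j <= N &
      forall f, f \in F -> enters t h f i j -> h f = v].

Lemma rooted_cup v i j i' j' : rooted v i j -> rooted v i' j' ->
  rooted v (minn i i') (maxn j j').
Proof.
move=> [i0 vij jN e] [i'0 vij' j'N e']; split; try lia.
move=> f fF [hf tf]; have [hij|hij] := boolP (i <= h f <= j).
  by apply: e => //; split; lia.
by apply: e' => //; split; lia.
Qed.

(** The private cut of a link with head [v] is rooted at [v], and by [rooted_cup] a longest rooted
    interval contains all the others. *)
Lemma territory_exists v : 0 < v <= N -> exists d : nat * nat,
  rooted v d.1 d.2 /\ forall i j, rooted v i j -> d.1 <= i /\ j <= d.2.
Proof.
move=> vN; have [|||f fF [hf _]] := @cut_entered v v; try lia.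
have {}hf : h f = v by lia.
have [i [j [i0 hij jN _ pf]]] := private_cut fF.
have rv : rooted v i j.
  by split; [lia|lia|lia|move=> g gF /(pf g gF) ->].
have [||m [[a [b [rab mE]]] mmax]] := @nat_max_exists
   (fun m => exists i j, rooted v i j /\ m = j - i) N (j - i).
- by exists i, j.
- by move=> m [a [b [[? ? ? _] ->]]]; lia.
exists (a, b); split=> //= a' b' r'.
have rr := rooted_cup rab r'; have := mmax _ (ex_intro _ _ (ex_intro _ _ (conj rr erefl))).
by case: rab => ? ? ? _; case: r' => ? ? ? _; lia.
Qed.

(** In-degree at most one: some link enters the union of the two private cuts, and since both
    contain the common head, it enters both. *)
Lemma same_head f g : f \in F -> g \in F -> h f = h g -> f = g.
Proof.
move=> fF gF hfg; have [i [j [i0 hij jN _ pf]]] := private_cut fF.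
have [i' [j' [i'0 hij' j'N _ pg]]] := private_cut gF.
have [|||e eF [he te]] := @cut_entered (minn i i') (maxn j j'); try lia.
have [heij|heij] := boolP (i <= h e <= j).
  have ef : e = f by apply: pf => //; split; lia.
  by subst e; apply: pg => //; split; lia.
have eg : e = g by apply: pg => //; split; lia.
by subst e; apply/esym/pf => //; split; lia.
Qed.

Variables dl dr : nat -> nat.
Hypothesis dP : forall v, 0 < v <= N -> rooted v (dl v) (dr v) /\
  forall i j, rooted v i j -> dl v <= i /\ j <= dr v.

(** The union of the two territories is rooted at [w]: a link entering it outside the territory of
    [w] would have head [v], which lies inside. *)
Lemma territory_sub v w : 0 < v <= N -> 0 < w <= N -> dl w <= v <= dr w ->
  dl w <= dl v /\ dr v <= dr w.
Proof.
move=> vN wN vw; have [[v0 vv vm ev] _] := dP vN.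
have [[w0 ww wm ew] mw] := dP wN.
suff /mw : rooted w (minn (dl v) (dl w)) (maxn (dr v) (dr w)) by lia.
split; try lia; move=> f fF [hf tf].
have [hw|hw] := boolP (dl w <= h f <= dr w); first by apply: ew => //; split; lia.
have : h f = v by apply: ev => //; split; lia.
by lia.
Qed.

Lemma territory_anti v w : 0 < v <= N -> 0 < w <= N ->
  dl w <= v <= dr w -> dl v <= w <= dr v -> v = w.
Proof.
move=> vN wN vw wv.
have := territory_sub vN wN vw; have := territory_sub wN vN wv.
have [[v0 vv vm ev] _] := dP vN; have [[w0 ww wm ew] _] := dP wN => s1 s2.
have [|||e eF ee] := @cut_entered (dl v) (dr v); try lia.
rewrite -(ev e eF ee); apply: ew => //.
have -> : dl w = dl v by lia.
by have -> : dr w = dr v by lia.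
Qed.

Lemma private_territory f : f \in F -> exists i j,
  [/\ 0 < i, i <= h f <= j, j <= N, (t f).+1 = i \/ t f = j.+1 &
      dl (h f) <= i /\ j <= dr (h f)] /\
      forall g, g \in F -> enters t h g i j -> g = f.
Proof.
move=> fF; have [i [j [i0 hij jN tf pf]]] := private_cut fF.
exists i, j; split=> //; split=> //.
have hN : 0 < h f <= N by lia.
apply: (dP hN).2; split=> // g gF /(pf g gF) -> //.
Qed.

(** The union of the territories of [h f] and [z] is rooted at [z]: a link entering it outside the
    latter has head [h f], hence is [f], whose tail lies inside. *)
Lemma territory_closed f z : f \in F -> 0 < z <= N ->
  dl z <= t f <= dr z -> dl z <= h f <= dr z.
Proof.
move=> fF zN tz; have [i [j [[i0 hij jN tf sub] pf]]] := private_territory fF.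
have hN : 0 < h f <= N by lia.
have [[v0 vv vm ev] _] := dP hN; have [[w0 ww wm ew] mw] := dP zN.
suff /mw : rooted z (minn (dl (h f)) (dl z)) (maxn (dr (h f)) (dr z)) by lia.
split; try lia; move=> g gF [hg tg].
have [hw|hw] := boolP (dl z <= h g <= dr z); first by apply: ew => //; split; lia.
have hgf : h g = h f by apply: ev => //; split; lia.
by have gf := same_head gF fF hgf; subst g; lia.
Qed.

(** Only one link leaves the root: the private cuts of two such links both start at position 1, so
    the link with the nearer head enters both. *)
Lemma whole_territory : 0 < N ->
  exists v, [/\ 0 < v <= N, dl v <= 1 & N <= dr v].
Proof.
move=> N0; have [|||f fF [hf tf]] := @cut_entered 1 N; try lia.
have tf0 := tail_le fF.
have [i [j [i0 hij jN tfij pf]]] := private_cut fF.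
exists (h f); have hN : 0 < h f <= N by lia.
suff /(dP hN).2 : rooted (h f) 1 N by split; lia.
split; try lia; move=> e eF [he te]; have te0 := tail_le eF.
have [i' [j' [i'0 hij' j'N teij pe]]] := private_cut eF.
have [hej|hej] := boolP (h e <= j).
  by rewrite (pf e) //; split; lia.
by rewrite (pe f) //; split; lia.
Qed.

(** Let [a .. b] be the side of [w] in its territory that contains [i .. j]. Private cuts of links
    with head in [a .. b] avoid [w], so a link [g] entering [a .. b] leaves from [w], and the
    territory of its head [z] fills the whole side. *)
Lemma territory_shrink w i j : 0 < w <= N -> dl w <= i -> j <= dr w ->
  i <= j -> ~ (i <= w <= j) ->
  exists z, [/\ 0 < z <= N, dl z <= i, j <= dr z & dr z - dl z < dr w - dl w].
Proof.
move=> wN wi jw ij wij; have [[w0 ww wm ew] _] := dP wN.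
have [a [b [aw bw ab aij side]]] : exists a b, [/\ dl w <= a, b <= dr w, 
   a <= b, a <= i /\ j <= b & (a = w.+1 /\ b = dr w) \/ (b.+1 = w /\ a = dl w)].
  by have [wi'|wi'] := ltnP w i; [exists w.+1, (dr w)|exists (dl w), w.-1]; split; lia.
have tailw g : g \in F -> enters t h g a b -> dl w <= t g <= dr w.
  move=> gF [hg tg]; apply/negP => tgw.
  suff : h g = w by lia.
  by apply: ew => //; split; lia.
have notw v : a <= v <= b -> ~ (dl v <= w <= dr v).
  move=> vab wv; have vN : 0 < v <= N by lia.
  have : v = w by apply: territory_anti => //; lia.
  by lia.
have [|||g gF eg] := @cut_entered a b; try lia.
have tgw := tailw g gF eg; have [hg tg] := eg.
have [i1 [j1 [[i10 hij1 j1N t1 sub1] p1]]] := private_territory gF.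
have nw := notw _ hg.
have {}tgw : t g = w by lia.
set z := h g in hg nw hij1 sub1; have zN : 0 < z <= N by lia.
have [[z0 zz zm ez] _] := dP zN.
have zw : dl w <= z <= dr w by lia.
have subzw := territory_sub zN wN zw.
suff : dl z <= a /\ b <= dr z by exists z; split; lia.
apply: contrapT => nsub.
(* If the territory of [z] misses the far part [c .. d], a link [g'] entering that part also leaves
   from [w]; then [g] enters the private cut of [g'], which forces [g = g']. *)
have [c [d [cd cda cdz side']]] : exists c d, [/\ c <= d, a <= c /\ d <= b,
   d < dl z \/ dr z < c & (a = w.+1 /\ c = (dr z).+1 /\ d = b) \/
     (b.+1 = w /\ c = a /\ d.+1 = dl z)].
  by case: side => side; [exists (dr z).+1, b|exists a, (dl z).-1]; split; lia.
have [|||g' gF' eg'] := @cut_entered c d; try lia.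
have [hg' tg'] := eg'.
have tgw' : dl w <= t g' <= dr w.
  apply/negP => tgw'; suff : h g' = w by lia.
  by apply: ew => //; split; lia.
have hg'' : a <= h g' <= b by lia.
have nw' := notw _ hg''.
have [i2 [j2 [[i20 hij2 j2N t2 sub2] p2]]] := private_territory gF'.
have ntz : ~ (dl z <= t g' <= dr z).
  by move=> tz; have := territory_closed gF' zN tz; lia.
have gg : g = g'.
  apply: p2 => //; split; rewrite -/z; last by lia.
  clear nsub notw nw subzw sub1 t1 hij1 i10 j1N eg' tg eg jw wi wij ij aij.
  by case: side => -[? ?]; case: side' => -[? [? ?]]; case: t2; lia.
by move: hg'; rewrite -gg -/z => hgz; clear -hgz zz cdz; lia.
Qed.

(** A smallest territory containing the interval has its vertex in the interval, since otherwise
    [territory_shrink] gives a smaller one. *)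
Lemma interval_top i j : 0 < i -> i <= j -> j <= N ->
  exists v, [/\ i <= v <= j, dl v <= i & j <= dr v].
Proof.
move=> i0 ij jN; have [|v0 [v0N v01 v0r]] := whole_territory; first lia.
have [|m [[w [wN wi jw mE]] mmin]] := @nat_min_exists (fun m => exists w,
    [/\ 0 < w <= N, dl w <= i, j <= dr w & m = dr w - dl w]) (dr v0 - dl v0).
  by exists v0; split; lia.
exists w; split=> //; apply/negP => /negP wij.
have [|z [zN zi jz zlt]] := territory_shrink wN wi jw ij; first lia.
have : m <= dr z - dl z by apply: mmin; exists z.
lia.
Qed.

End Territories.

(** * Festoons *)

Section Festoons.
Variables (L : finType) (la lb : L -> nat) (N : nat).

Definition cov (l : L) (i j : nat) : bool :=
  (i <= la l <= j) != (i <= lb l <= j).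

(* Gap [g] lies between the positions [g] and [g.+1]. *)
Definition over (U : {set L}) (g : nat) : bool :=
  [exists l in U, la l <= g < lb l].

Definition solid (U : {set L}) (i j : nat) : bool :=
  (i < j <= N) && [forall g : 'I_N, (i <= g < j) ==> over U g].

Lemma solidP (U : {set L}) i j :
  reflect (i < j <= N /\ forall g, i <= g < j ->
             exists2 l, l \in U & la l <= g < lb l) (solid U i j).
Proof.
apply: (iffP andP) => -[ij ov]; split=> //.
  move=> g ig; have gN : g < N by lia.
  by have /implyP/(_ ig)/exists_inP := forallP ov (Ordinal gN).
by apply/forallP => g; apply/implyP => ig; apply/exists_inP/ov.
Qed.

(** * Inclusion-minimal covers of an interval *)

Section MinimalCover.
Variables (X : {set L}) (i j : nat).
Hypothesis link_lt : forall l, l \in X -> la l < lb l.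
Hypothesis minX : minset (fun Y => solid Y i j) X.

Lemma private_gap l : l \in X -> exists g, [/\ i <= g < j, la l <= g < lb l &
  forall m, m \in X -> la m <= g < lb m -> m = l].
Proof.
move=> lX; have [/solidP[ij sX] mX] := minsetP minX.
apply: contrapT => npriv; suff sXl : solid (X :\ l) i j.
  by have := mX _ sXl (subD1set X l); move/setP/(_ l); rewrite !inE eqxx lX.
apply/solidP; split=> // g ig; have [m mX' mg] := sX g ig.
have [ml|nml] := eqVneq m l; last by exists m; rewrite // !inE nml.
apply: contrapT => nex; apply: npriv; exists g; split=> //; first by rewrite -ml.
move=> p pX pg; apply: contrapT => /eqP npl; apply: nex; exists p => //.
by rewrite !inE npl.
Qed.

(* Of three links over [g], two have their private gaps on the same side of [g],
   and one of these two passes over the private gap of the other. *)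
Lemma card_over_gap g : #|[set l in X | la l <= g < lb l]| <= 2.
Proof.
rewrite leqNgt; apply/negP => /card_gt2P[x [y [z [[]]]]].
rewrite !inE => /andP[xX xg] /andP[yX yg] /andP[zX zg] [nxy nyz nzx].
have [gx [_ cx px]] := private_gap xX.
have [gy [_ cy py]] := private_gap yX.
have [gz [_ cz pz]] := private_gap zX.
have dis u v gu gv : u \in X -> v \in X -> u != v -> la u <= g < lb u ->
  la v <= g < lb v -> la u <= gu < lb u -> la v <= gv < lb v ->
  (forall m, m \in X -> la m <= gu < lb m -> m = u) ->
  (forall m, m \in X -> la m <= gv < lb m -> m = v) ->
  gu < g < gv \/ gv < g < gu.
  move=> uX vX /eqP nuv ug vg cu cv pu pv.
  have nv : ~ (la v <= gu < lb v) by move=> /(pu _ vX)/esym.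
  have nu : ~ (la u <= gv < lb u) by move=> /(pv _ uX).
  by lia.
have := dis x y gx gy xX yX nxy xg yg cx cy px py.
have := dis y z gy gz yX zX nyz yg zg cy cz py pz.
have := dis z x gz gx zX xX nzx zg xg cz cx pz px.
lia.
Qed.

Lemma card_cov_minimal c d : c <= d -> #|[set l in X | cov l c d]| <= 4.
Proof.
move=> cd; pose O g := [set l in X | la l <= g < lb l].
(* A link covering [c .. d] passes over the gap before [c] or the gap after [d]. *)
apply: (@leq_trans #|O c.-1 :|: O d|).
  apply/subset_leq_card/subsetP => l; rewrite !inE /cov => /andP[lX].
  by have := link_lt lX; rewrite lX /=; lia.
rewrite (leq_trans (leq_card_setU _ _)) // (leq_add (card_over_gap _) (card_over_gap _)) //.
Qed.

(** Suppose no link of [X] covers [c .. d]; then both ends of [l], hence its private gap, lie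
    inside. A link over a boundary gap of [c .. d] within [i .. j] would have to span [c .. d], and
    so pass over that private gap. *)
Lemma minimal_linked l c d : l \in X -> c <= la l <= d \/ c <= lb l <= d ->
  i < c \/ d < j -> exists2 m, m \in X & cov m c d.
Proof.
move=> lX lcd ij; apply: contrapT => ncov.
have {}ncov m : m \in X -> ~~ cov m c d.
  by move=> mX; apply/negP => mc; apply: ncov; exists m.
have [/solidP[ij' sX] _] := minsetP minX.
have [g [gij lg pg]] := private_gap lX.
have nl := ncov _ lX; rewrite /cov in nl.
have out h : i <= h < j -> h.+1 = c \/ h = d -> False.
  move=> hij hcd; have [m mX mh] := sX h hij.
  have := ncov m mX; rewrite /cov => nm.
  have ml : m = l by apply: pg => //; lia.
  by subst m; lia.
case: ij => ij; first by apply: (out c.-1); lia.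
by apply: (out d); lia.
Qed.

End MinimalCover.

(* Block [r] is the set of links of rank [r], with hull [lo r .. hi r]; blocks
   chosen earlier have a larger rank. *)
Record festoons (U : {set L}) (rk : L -> nat) (lo hi : nat -> nat) : Prop := {
  fe_rank : forall l, l \in U -> rk l < #|U|;
  fe_hull : forall l, l \in U -> lo (rk l) <= la l /\ lb l <= hi (rk l);
  fe_linked : forall l c d, l \in U ->
    c <= la l <= d \/ c <= lb l <= d ->
    lo (rk l) < c \/ d < hi (rk l) ->
    exists m, [/\ m \in U, rk m = rk l & cov m c d];
  fe_card : forall r c d, c <= d ->
    #|[set l in U | (rk l == r) && cov l c d]| <= 4;
  fe_laminar : forall l m, l \in U -> m \in U -> rk l < rk m ->
    [\/ hi (rk l) < lo (rk m), hi (rk m) < lo (rk l) |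
        lo (rk m) <= lo (rk l) /\ hi (rk l) <= hi (rk m)];
  fe_solid : forall l, l \in U -> solid U (lo (rk l)) (hi (rk l))
}.

Lemma solid_sub (U W : {set L}) i j : U \subset W -> solid U i j -> solid W i j.
Proof.
move=> /subsetP UW /solidP[ij s]; apply/solidP; split=> // g /s[l lU lg].
by exists l => //; apply: UW.
Qed.

Lemma solid_union (U : {set L}) i j i' j' : solid U i j -> solid U i' j' ->
  i <= j' -> i' <= j -> solid U (minn i i') (maxn j j').
Proof.
move=> /solidP[ij s] /solidP[ij' s'] ? ?; apply/solidP; split; first lia.
move=> g gij; have [gi|gi] := boolP (i <= g < j); first exact: s.
by apply: s'; lia.
Qed.

Lemma festoons_exist (U : {set L}) :
  (forall l, l \in U -> la l < lb l <= N) ->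
  exists rk lo hi, festoons U rk lo hi.
Proof.
move: {2}#|U|.+1 (ltnSn #|U|) => n; elim: n U => // n IH U Un linkU.
have [->|[l0 l0U]] := set_0Vmem U.
  exists (fun=> 0), (fun=> 0), (fun=> 0); split=> [l|l|l|r c d _|l|l]; rewrite ?inE //.
  by rewrite (eq_card0 (A := [set _ in _ | _])) // => l; rewrite !inE.
have [||m [[i [j [sU mE]]] mmax]] := @nat_max_exists
    (fun m => exists i j, solid U i j /\ m = j - i) N (lb l0 - la l0).
- exists (la l0), (lb l0); split=> //; apply/solidP; split; first exact: linkU.
  by move=> g lg; exists l0.
- by move=> m [i [j [/solidP[ij _] ->]]]; lia.
(* A solid interval meeting the longest one forms a solid union with it, hence lies inside it; this
   makes the hulls laminar. *)
have {}mmax i' j' : solid U i' j' -> i' <= j -> i <= j' -> i <= i' /\ j' <= j.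
  move=> s' ij' ji'; have s := solid_union sU s' ji' ij'.
  have := mmax _ (ex_intro _ _ (ex_intro _ _ (conj s erefl))).
  by case/solidP: s' => s' _; case/solidP: sU => ij _; lia.
have [X minX XU] := minset_exists (P := fun Y => solid Y i j) sU.
have /minsetP[sX _] := minX.
have linkX l : l \in X -> la l < lb l.
  by move=> /(subsetP XU)/linkU; lia.
have ij : i < j <= N by case/solidP: sU.
have [||rk [lo [hi fe]]] := IH (U :\: X).
- have [x xX _] : exists2 x, x \in X & la x <= i < lb x.
    by case/solidP: sX => _; apply; lia.
  have : #|U :\: X| < #|U|.
    apply/proper_card/properP; split; first exact: subsetDl.
    by exists x; rewrite ?inE ?xX // (subsetP XU).
  by lia.
- by move=> l; rewrite inE => /andP[_ /linkU].
have XltU : #|U :\: X| < #|U|.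
  have [x xX _] : exists2 x, x \in X & la x <= i < lb x.
    by case/solidP: sX => _; apply; lia.
  apply/proper_card/properP; split; first exact: subsetDl.
  by exists x; rewrite ?inE ?xX // (subsetP XU).
(* The block [X] is chosen first and gets the largest rank; the remaining links have ranks below
   [#|U :\: X|]. *)
pose M := #|U|.-1.
pose rk' l := if l \in X then M else rk l.
pose lo' r := if r == M then i else lo r.
pose hi' r := if r == M then j else hi r.
have rkX l : l \in X -> rk' l = M by rewrite /rk' => ->.
have rkD l : l \in U -> l \notin X -> rk' l = rk l /\ rk l < M.
  move=> lU lX; rewrite /rk' (negPf lX); split=> //.
  have lD : l \in U :\: X by rewrite inE lX.
  by have := fe_rank fe lD; rewrite /M; lia.
have loX : lo' M = i by rewrite /lo' eqxx.
have hiX : hi' M = j by rewrite /hi' eqxx.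
have hullD r : r < M -> lo' r = lo r /\ hi' r = hi r.
  by move=> rM; rewrite /lo' /hi'; have -> : (r == M) = false by lia.
have hullX l : l \in X -> i <= la l /\ lb l <= j.
  move=> lX; have [g [gij lg _]] := private_gap minX lX.
  have lU := linkU _ (subsetP XU _ lX).
  apply: mmax; try lia; apply/solidP; split; first lia.
  by move=> h hl; exists l => //; apply: (subsetP XU).
exists rk', lo', hi'; split.
- move=> l lU; have [lX|lX] := boolP (l \in X); first by rewrite rkX // /M; lia.
  by have [-> ?] := rkD l lU lX; rewrite /M in XltU *; lia.
- move=> l lU; have [lX|lX] := boolP (l \in X); first by rewrite rkX // loX hiX; apply: hullX.
  have [-> rM] := rkD l lU lX; have [-> ->] := hullD _ rM.
  by apply: (fe_hull fe); rewrite inE lX.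
- move=> l c d lU; have [lX|lX] := boolP (l \in X).
    rewrite rkX // loX hiX => tl /(minimal_linked minX lX tl)[p pX pc].
    by exists p; rewrite (subsetP XU) // rkX.
  have [-> rM] := rkD l lU lX; have [-> ->] := hullD _ rM => tl out.
  have [|p [pD pl pc]] := fe_linked fe _ tl out; first by rewrite inE lX.
  move: pD; rewrite inE => /andP[pX pU]; exists p; split=> //.
  by have [->] := rkD p pU pX.
- move=> r c d cd; have [->|rM] := eqVneq r M.
    rewrite (leq_trans _ (card_cov_minimal linkX minX cd)) //.
    apply/subset_leq_card/subsetP => l; rewrite !inE => /and3P[lU /eqP lM ->].
    rewrite andbT; apply/negPn/negP => lX.
    by have [e ?] := rkD l lU lX; lia.
  rewrite (leq_trans _ (fe_card fe r cd)) //.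
  apply/subset_leq_card/subsetP => l; rewrite !inE => /and3P[lU /eqP lr ->].
  have lX : l \notin X by apply/negP => /rkX; lia.
  by have [e _] := rkD l lU lX; rewrite lX lU -lr e eqxx.
- move=> l p lU pU; have [pX|pX] := boolP (p \in X).
    rewrite (rkX p pX) loX hiX => lM.
    have lX : l \notin X by apply/negP => /rkX; lia.
    have [e rM] := rkD l lU lX; rewrite e; have [-> ->] := hullD _ rM.
    have lD : l \in U :\: X by rewrite inE lX.
    have sl := solid_sub (subsetDl U X) (fe_solid fe lD).
    have [h1|h1] := ltnP (hi (rk l)) i; first by constructor 1.
    have [h2|h2] := ltnP j (lo (rk l)); first by constructor 2.
    by constructor 3; apply: mmax.
  have [-> pM] := rkD p pU pX; have [-> ->] := hullD _ pM.
  have [lX|lX] := boolP (l \in X); first by rewrite rkX //; lia.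
  have [-> lM] := rkD l lU lX; have [-> ->] := hullD _ lM.
  by apply: (fe_laminar fe); rewrite inE ?lX ?pX.
- move=> l lU; have [lX|lX] := boolP (l \in X); first by rewrite rkX // loX hiX.
  have [-> rM] := rkD l lU lX; have [-> ->] := hullD _ rM.
  apply: (solid_sub (subsetDl U X)).
  by apply: (fe_solid fe); rewrite inE lX.
Qed.

End Festoons.

(** * Dependencies between blocks *)

Section Dependency.
Variables (L : finType) (la lb : L -> nat) (N : nat) (S : {set L}).
Variables (rk : L -> nat) (lo hi : nat -> nat).
Hypothesis fe : festoons la lb N S rk lo hi.
Hypothesis link_lt : forall l, l \in S -> la l < lb l.
Hypothesis cut_covered : forall i j, 0 < i -> i <= j -> j <= N ->
  exists2 l, l \in S & cov la lb l i j.
Variables dl dr : nat -> nat.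
Hypothesis d_bounds : forall v, 0 < v <= N -> 0 < dl v <= v /\ v <= dr v <= N.
Hypothesis d_anti : forall v w, 0 < v <= N -> 0 < w <= N ->
  dl w <= v <= dr w -> dl v <= w <= dr v -> v = w.

Definition block (r : nat) : Prop := exists2 l, l \in S & rk l = r.

Definition touches (r i j : nat) : Prop := exists l,
  [/\ l \in S, rk l = r & i <= la l <= j \/ i <= lb l <= j].

Definition tangled (r s : nat) : Prop :=
  [/\ block r, r < s & touches s (lo r) (hi r)].

Definition exits (v r : nat) : bool := ~~ ((dl v <= lo r) && (hi r <= dr v)).

Definition inner (r : nat) : Prop := block r /\ 0 < lo r.

Lemma block_lt r : block r -> r < #|S|.
Proof. by case=> l lS <-; apply: (fe_rank fe). Qed.

Lemma block_hull r : block r -> lo r < hi r <= N.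
Proof. by case=> l lS <-; have /andP[] := fe_solid fe lS. Qed.

Lemma touches_block r i j : touches r i j -> block r.
Proof. by case=> l [lS <- _]; exists l. Qed.

Lemma touches_hull r i j : touches r i j -> lo r <= j /\ i <= hi r.
Proof.
by case=> l [lS <- tl]; have := link_lt lS; have := fe_hull fe lS; lia.
Qed.

Lemma touches_sub r i j i' j' : touches r i j -> i' <= i -> j <= j' ->
  touches r i' j'.
Proof. by case=> l [lS rl tl] ? ?; exists l; split=> //; lia. Qed.

Lemma tangled_block r s : tangled r s -> block s.
Proof. by case=> _ _ /touches_block. Qed.

Lemma hull_laminar r s : block r -> block s -> r < s ->
  [\/ hi r < lo s, hi s < lo r | lo s <= lo r /\ hi r <= hi s].
Proof. by case=> l lS <- [m mS <-]; apply: (fe_laminar fe). Qed.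

Lemma tangled_hull r s : tangled r s -> lo s <= lo r /\ hi r <= hi s.
Proof.
move=> rs; have [br rls tc] := rs; have bs := tangled_block rs.
by have := touches_hull tc; case: (hull_laminar br bs rls); lia.
Qed.

Lemma tangled_next r s t : tangled r s -> tangled r t -> s < t -> tangled s t.
Proof.
move=> rs [_ _ tc] st; split=> //; first exact: tangled_block rs.
by have [? ?] := tangled_hull rs; apply: touches_sub tc _ _.
Qed.

Lemma block_cov r i j : touches r i j -> lo r < i \/ j < hi r ->
  exists l, [/\ l \in S, rk l = r & cov la lb l i j].
Proof.
case=> l [lS <- tl] out; exact: (fe_linked fe lS tl out).
Qed.

(** The hull of [r] is a cut, and a link covering it has one end outside; by laminarity that link
    belongs to a block chosen before [r]. *)
Lemma tangled_exists r : inner r -> exists s, tangled r s.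
Proof.
move=> [br lo0]; have hr := block_hull br.
have [|||l lS lc] := @cut_covered (lo r) (hi r); try lia.
have hl := fe_hull fe lS; have ll := link_lt lS; rewrite /cov in lc.
have bl : block (rk l) by exists l.
have tl : touches (rk l) (lo r) (hi r) by exists l; split=> //; lia.
exists (rk l); split=> //.
have [//|lr|lr] := ltngtP r (rk l); last by move: lc; rewrite lr; lia.
by case: (hull_laminar bl br lr); lia.
Qed.

Lemma block_ind (P : nat -> Prop) :
  (forall r, block r -> (forall s, block s -> r < s -> P s) -> P r) ->
  forall r, block r -> P r.
Proof.
move=> step r; move: {2}(#|S| - r) (leqnn (#|S| - r)) => n.
elim: n r => [|n IH] r rn br; have := block_lt br; first lia.
by move=> rS; apply: step => // s bs rs; apply: IH => //; lia.
Qed.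

Variables top nxt st lam : nat -> nat.
Hypothesis topP : forall r, inner r ->
  lo r <= top r <= hi r /\ ~~ exits (top r) r.
Hypothesis nxtP : forall r, inner r -> tangled r (nxt r) /\
  ((exits (top r) (nxt r) /\
    forall s, tangled r s -> exits (top r) s -> nxt r <= s) \/
   (forall s, tangled r s -> ~~ exits (top r) s /\ s <= nxt r)).
Hypothesis stP : forall v, 0 < v <= N -> touches (st v) v v.
Hypothesis lamP : forall r, inner r -> lam r = lam (nxt r) + exits (top r) (nxt r).

(** The blocks reached from [st v] before the pointers leave the territory of [v]. [nxt] refers to
    [top r] rather than to [v]; by [on_chain_hull] the two agree here. *)
Definition on_chain (v r : nat) : Prop := exists n, r = iter n nxt (st v) /\
  forall m, m <= n -> ~~ exits v (iter m nxt (st v)).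

Lemma inner_in v r : 0 < v <= N -> block r -> ~~ exits v r -> inner r.
Proof. by move=> vN br; have := d_bounds vN; rewrite /exits => ? ?; split=> //; lia. Qed.

Lemma top_unique v r : 0 < v <= N -> block r -> lo r <= v <= hi r ->
  ~~ exits v r -> top r = v.
Proof.
move=> vN br vr ev; have ir := inner_in vN br ev; have [tr et] := topP ir.
have hr := block_hull br; have := ir.2; move: ev et; rewrite /exits => *.
by apply: d_anti; lia.
Qed.

Lemma on_chain_hull v r : 0 < v <= N -> on_chain v r ->
  [/\ block r, lo r <= v <= hi r, ~~ exits v r, inner r & top r = v].
Proof.
move=> vN [n [-> ne]].
have [br vr] : block (iter n nxt (st v)) /\
    lo (iter n nxt (st v)) <= v <= hi (iter n nxt (st v)).
  elim: n ne => [|n IH] ne /=.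
    have tc := stP vN; split; first exact: touches_block tc.
    by have := touches_hull tc; lia.
  have [|bn vn] := IH; first by move=> m mn; apply: ne; lia.
  have [tn _] := nxtP (inner_in vN bn (ne n (leqnSn n))).
  by split; [apply: tangled_block tn|have := tangled_hull tn; lia].
have en := ne n (leqnn n); split=> //; first exact: inner_in en.
exact: top_unique.
Qed.

Lemma on_chain_next v r : on_chain v r -> ~~ exits v (nxt r) -> on_chain v (nxt r).
Proof.
move=> [n [-> ne]] en; exists n.+1; split=> // m.
by rewrite leq_eqVlt => /orP[/eqP ->|/ne].
Qed.

Lemma on_chain_lt v r s : 0 < v <= N -> on_chain v r -> on_chain v s -> r < s ->
  ~~ exits v (nxt r) /\ nxt r <= s.
Proof.
move=> vN [a [-> ea]] [b [-> eb]].
have mono c : (forall m, m <= c -> ~~ exits v (iter m nxt (st v))) ->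
    forall m, m <= c -> iter m nxt (st v) <= iter c nxt (st v).
  elim: c => [|c IH] ec m; first by rewrite leqn0 => /eqP ->.
  rewrite leq_eqVlt => /orP[/eqP -> //|mc].
  have ec' m' : m' <= c -> ~~ exits v (iter m' nxt (st v)) by move=> ?; apply: ec; lia.
  apply: leq_trans (IH ec' m mc) _.
  have [|_ _ _ /nxtP[[_ lt _] _] _] := @on_chain_hull v (iter c nxt (st v)) vN.
    by exists c.
  exact: ltnW lt.
have [ab|ba] := ltnP a b; last by have := mono a ea b ba; lia.
by move=> _; split; [apply: (eb a.+1)|apply: (mono b eb a.+1)].
Qed.

(** * Classes of blocks after cutting pointers *)

Variables (k c : nat).
Hypothesis c_lt : c < k.

(* The blocks whose pointer is cut: besides those of the sacrificed class, the
   ones that no vertex needs, so that tangled blocks of a class with the same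
   top lie on one chain. *)
Definition stop (r : nat) : Prop :=
  [\/ ~ inner r, ~ on_chain (top r) r | lam r %% k = c].

Variable rep : nat -> nat.
Hypothesis rep_stop : forall r, stop r -> rep r = r.
Hypothesis rep_next : forall r, ~ stop r -> rep r = rep (nxt r).

Lemma nonstop r : ~ stop r -> [/\ inner r, on_chain (top r) r & lam r %% k <> c].
Proof.
move=> nr; split=> [||lr]; last by apply: nr; constructor 3.
  by apply: contrapT => h; apply: nr; constructor 1.
by apply: contrapT => h; apply: nr; constructor 2.
Qed.

Lemma top_range r : inner r -> 0 < top r <= N.
Proof.
by move=> ir; have [? _] := topP ir; have := block_hull ir.1; have := ir.2; lia.
Qed.

Lemma rep_facts r : block r -> [/\ r <= rep r, stop (rep r),
  rep (rep r) = rep r & lo (rep r) <= lo r /\ hi r <= hi (rep r)].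
Proof.
move: r; apply: block_ind => r br IH; have [sr|nsr] := EM (stop r).
  by rewrite (rep_stop sr); split=> //; apply: rep_stop.
have [ir _ _] := nonstop nsr; have [tn _] := nxtP ir; have [_ lt _] := tn.
have [? ? ? ?] := IH _ (tangled_block tn) lt; have := tangled_hull tn.
by rewrite (rep_next nsr); split=> //; lia.
Qed.

Lemma rep_neq r : block r -> r <> rep r -> ~ stop r.
Proof. by move=> br nr /rep_stop e; apply: nr; rewrite e. Qed.

(** While the pointers stay in the territory of [top r], they stay on its chain and [lam] does not
    change, so none of these blocks is a stop, as [r] is none. *)
Lemma rep_exits r : block r -> r <> rep r -> exits (top r) (rep r).
Proof.
move: r; apply: block_ind => r br IH nr; have nsr := rep_neq br nr.
have [ir cr lr] := nonstop nsr; have [tn _] := nxtP ir; have [_ lt _] := tn.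
have bn := tangled_block tn; have vN := top_range ir.
rewrite (rep_next nsr); have [n_s n_stop n_rr n_h] := rep_facts bn.
have [en|en] := boolP (exits (top r) (nxt r)); first by move: en; rewrite /exits; lia.
have cn := on_chain_next cr en; have [_ _ _ inn tpn] := on_chain_hull vN cn.
have [e|ne] := EM (nxt r = rep (nxt r)).
  suff : ~ stop (nxt r) by rewrite e => /(_ n_stop).
  case=> //; first by rewrite tpn => /(_ cn).
  by move: lr; rewrite (lamP ir) (negbTE en) addn0.
by rewrite -tpn; apply: IH.
Qed.

(** A pointer lowers [lam] by at most one, and no uncut block has [lam] in the class [c]; so on the
    way back from the representative to [r], [lam] cannot get past the next value of that class. *)
Lemma lam_window r : block r -> r <> rep r -> lam (rep r) < lam r /\
  forall d, d %% k = c -> lam (rep r) < d -> lam r < d.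
Proof.
move: r; apply: block_ind => r br IH nr; have nsr := rep_neq br nr.
have [ir cr lr] := nonstop nsr; have [tn _] := nxtP ir; have [_ lt _] := tn.
have bn := tangled_block tn; have er := rep_exits br nr.
move: er; rewrite (rep_next nsr) => er.
have neq d : d %% k = c -> lam r <> d by move=> dc e; apply: lr; rewrite e.
have lr' := lamP ir.
have [e|ne] := EM (nxt r = rep (nxt r)).
  move: lr'; rewrite {2}e er -e addn1 => lr'; split; first by lia.
  by move=> d dc ld; have := neq d dc; lia.
have [lz lw] := IH _ bn lt ne; split; first by lia.
by move=> d dc ld; have := neq d dc; have := lw d dc ld; have := leq_b1 (exits (top r) (nxt r)); lia.
Qed.

(** By [rep_exits], [s] is not the representative, so it lies on the chain of [top r], and [nxt r]
    stays in the territory too. Thus the pointer of [r] goes to the largest tangled block, which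
    cannot exceed [s]. *)
Lemma tangled_inside r s : tangled r s -> rep r = rep s ->
  ~~ exits (top r) s ->
  [/\ s = nxt r, lam s = lam r & forall t, tangled r t -> ~~ exits (top r) t].
Proof.
move=> rs ers es; have [br lrs _] := rs; have bs := tangled_block rs.
have [les _ _ _] := rep_facts bs.
have nr : r <> rep r by lia.
have nsr := rep_neq br nr; have [ir cr _] := nonstop nsr.
have vN := top_range ir; have [tr _] := topP ir.
have ts : top s = top r by apply: top_unique => //; have := tangled_hull rs; lia.
have ns : s <> rep s.
  by move=> e; have := rep_exits br nr; rewrite ers -e (negbTE es).
have [is_ cs _] := nonstop (rep_neq bs ns); rewrite ts in cs.
have [en nls] := on_chain_lt vN cr cs lrs.
have [tn [[en' _]|inn]] := nxtP ir; first by rewrite en' in en.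
have e : s = nxt r by have := (inn s rs).2; lia.
split=> // [|t /inn[] //].
by rewrite (lamP ir) -e (negbTE es) addn0.
Qed.

(** The pointer of [r] goes to the smallest tangled block leaving the territory, which lowers [lam];
    that block is [s] or is itself tangled with [s], and induction or [tangled_inside] applies. *)
Lemma tangled_exits_lam r s : tangled r s -> rep r = rep s ->
  exits (top r) s -> lam s < lam r.
Proof.
move=> rs ers es; have [br _ _] := rs.
move: r br s rs ers es; apply: block_ind => r br IH s rs ers es.
have bs := tangled_block rs; have [les _ _ _] := rep_facts bs.
have [_ lrs _] := rs.
have nsr : ~ stop r by apply: rep_neq => //; lia.
have [ir _ _] := nonstop nsr.
have [tn [[en mn]|inn]] := nxtP ir; last by have := (inn s rs).1; rewrite es.
have [_ lt _] := tn.
have lr := lamP ir; rewrite en addn1 in lr.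
have := mn s rs es; rewrite leq_eqVlt => /orP[/eqP <-|ns]; first by rewrite lr.
have nts := tangled_next tn rs ns.
have ens : rep (nxt r) = rep s by rewrite -(rep_next nsr).
have [e|e] := boolP (exits (top (nxt r)) s).
  by have := IH _ (tangled_block tn) lt s nts ens e; lia.
by have [_ -> _] := tangled_inside nts ens e; rewrite lr.
Qed.

(** The block [r] is not a stop, so its hull is laminar with [i .. j]; a link of [r] covers
    [i .. j], so the hull contains [i .. j], and with it an end of the link of [s]. *)
Lemma crossing_tangled r s i j : i <= j ->
  (forall r, inner r -> [\/ hi r < i, j < lo r, lo r <= i /\ j <= hi r |
                            i <= lo r /\ hi r <= j]) ->
  r < s -> rep r = rep s ->
  (exists l, [/\ l \in S, rk l = r & cov la lb l i j]) ->
  (exists l, [/\ l \in S, rk l = s & cov la lb l i j]) -> tangled r s.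
Proof.
move=> ij lam_ij rs ers [l [lS lr lc]] [m [mS ms mc]].
have br : block r by exists l.
have bs : block s by exists m.
have [les _ _ _] := rep_facts bs.
have nsr : ~ stop r by apply: rep_neq => //; lia.
have [ir _ _] := nonstop nsr.
have := fe_hull fe lS; have := link_lt lS; have := link_lt mS.
move: lc mc; rewrite lr /cov => lc mc ? ? ?.
split=> //; exists m; split=> //.
by case: (lam_ij r ir); lia.
Qed.

Lemma card_cov_class z i j : i <= j ->
  (forall r, inner r -> [\/ hi r < i, j < lo r, lo r <= i /\ j <= hi r |
                            i <= lo r /\ hi r <= j]) ->
  #|[set l in S | (rep (rk l) == z) && cov la lb l i j]| <= 4 * k.
Proof.
move=> ij lam_ij; set K := [set l in S | _].
have rkS l : l \in S -> rk l < #|S| by apply: (fe_rank fe).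
have [K0|[l0 l0K]] := set_0Vmem K; first by rewrite K0 cards0.
have l0S : l0 \in S by move: l0K; rewrite inE => /andP[].
have S0 : #|S|.-1.+1 = #|S| by have := rkS _ l0S; lia.
pose R := [set (inord (rk l) : 'I_#|S|.-1.+1) | l in K].
have rkR l : l \in S -> (inord (rk l) : 'I_#|S|.-1.+1) = rk l :> nat.
  by move=> lS; rewrite inordK // S0 rkS.
have RP r : r \in R -> rep r = z /\
    exists l, [/\ l \in S, rk l = r & cov la lb l i j].
  case/imsetP => l; rewrite inE => /and3P[lS /eqP lz lc] ->.
  by rewrite rkR //; split=> //; exists l.
suff Rk : #|R| <= k.
  rewrite -sum1_card (partition_big (fun l => inord (rk l) : 'I_#|S|.-1.+1) (mem R)) /=;
    last by move=> l lK; apply: imset_f.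
  apply: (@leq_trans (\sum_(r in R) 4)); last by rewrite sum_nat_const mulnC leq_mul2l.
  apply: leq_sum => r rR; rewrite sum1_card.
  apply: leq_trans (fe_card fe r ij); apply/subset_leq_card/subsetP => l.
  rewrite unfold_in /= => /andP[]; rewrite !inE => /and3P[lS _ ->] /eqP <-.
  by rewrite lS rkR // eqxx.
have tR r s : r \in R -> s \in R -> r < s -> tangled r s /\ rep r = rep s.
  move=> /RP[rz rl] /RP[sz sl] rs; have ers : rep r = rep s by rewrite rz sz.
  by split=> //; apply: crossing_tangled rs ers rl sl.
have r0R : inord (rk l0) \in R by apply: imset_f.
have [m mR mmax] := @arg_maxnP _ _ (mem R) (fun r => r : nat) r0R.
have mlt r : r \in R -> r != m -> r < m.
  by move=> rR /eqP rm; have /= := mmax r rR; rewrite leq_eqVlt => /orP[/eqP/val_inj|].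
have win r : r \in R -> r != m -> lam z < lam r < lam z + k.
  move=> rR rm; have [trm _] := tR _ _ rR mR (mlt r rR rm).
  have [br lrm _] := trm; have [rz _] := RP r rR; have [mz _] := RP m mR.
  have [lez _ _ _] := rep_facts (tangled_block trm).
  have nr : r <> rep r :> nat by lia.
  have [lz lw] := lam_window br nr; rewrite rz in lz lw; rewrite lz /=.
  (* The least value above [lam z] in the class [c]. *)
  pose d := if lam z < c then c else c + ((lam z - c) %/ k).+1 * k.
  have dz : lam z < d <= lam z + k.
    have k0 : 0 < k by lia.
    rewrite /d; have := divn_eq (lam z - c) k; have := ltn_pmod (lam z - c) k0.
    by case: (ltnP (lam z) c) => lzc _; rewrite ?mulSn; lia.
  apply: leq_trans (lw d _ _) _; try lia.
  rewrite /d; case: ifP => _; last by rewrite addnC modnMDl; rewrite modn_small.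
  by rewrite modn_small.
have k0 : k.-1.+1 = k by lia.
(* The last block takes the value 0, which the others miss because their [lam] exceeds [lam z]. *)
pose f (r : 'I_#|S|.-1.+1) : 'I_k.-1.+1 := inord (if r == m then 0 else lam r - lam z).
suff finj : {in R &, injective f} by rewrite (leq_trans (leq_card_in f _ finj)) ?card_ord ?k0.
have fE r : r \in R -> f r = (if r == m then 0 else lam r - lam z) :> nat.
  by move=> rR; rewrite inordK // k0; case: eqVneq => [_|rm]; first lia; have := win r rR rm; lia.
have dis r s : r \in R -> s \in R -> r < s -> f r <> f s.
  move=> rR sR rs /(congr1 val) /=; rewrite !fE //.
  have [rm|rm] := eqVneq r m; first by have /= := mmax s sR; rewrite -rm; lia.
  have := win r rR rm; have [sm|sm] := eqVneq s m; first by lia.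
  have := win s sR sm => ws wr frs.
  have [trs ers] := tR r s rR sR rs.
  have [trm erm] := tR r m rR mR (mlt r rR rm).
  have [es|es] := boolP (exits (top r) s).
    have := tangled_exits_lam trs ers es.
    by clear -ws wr frs; lia.
  (* If [s] stays in the territory, then so does [m], and both equal [nxt r], contradicting
     [s != m]. *)
  have [se _ inn] := tangled_inside trs ers es.
  have [me _ _] := tangled_inside trm erm (inn m trm).
  by move/eqP: sm => []; apply: val_inj; rewrite /= se me.
move=> r s rR sR frs; apply: val_inj => /=.
by have [rs|rs|//] := ltngtP r s; [case: (dis r s)|case: (dis s r)].
Qed.

(** Follow the chain from [st v]. A block touching [i .. j] whose hull sticks out covers [i .. j] by
    [fe_linked]; otherwise its hull lies in the territory of [v] and the block is no stop, so the
    next block touches [i .. j] and has the same class. *)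
Lemma class_covers v i j : 0 < v <= N -> lam (st v) %% k <> c ->
  i <= v <= j -> dl v <= i -> j <= dr v ->
  exists l, [/\ l \in S, rep (rk l) = rep (st v) & cov la lb l i j].
Proof.
move=> vN lv vij di dj.
have key r : block r -> touches r i j -> rep r = rep (st v) -> 
    lam r %% k <> c -> on_chain v r \/ exits v r ->
    exists l, [/\ l \in S, rep (rk l) = rep (st v) & cov la lb l i j].
  move: r; apply: block_ind => r br IH tr er lr cr.
  have [out|inside] := EM (lo r < i \/ j < hi r).
    by have [l [lS lE lc]] := block_cov tr out; exists l; rewrite lE.
  have {}cr : on_chain v r by case: cr => //; rewrite /exits; lia.
  have [_ _ _ ir tp] := on_chain_hull vN cr.
  have nsr : ~ stop r by case=> //; rewrite tp => /(_ cr).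
  have [tn _] := nxtP ir; have [_ lt tc] := tn.
  have tc' : touches (nxt r) i j by apply: touches_sub tc _ _; lia.
  have [en|en] := boolP (exits v (nxt r)).
    have hn := tangled_hull tn.
    have [l [lS lE lc]] : exists l, [/\ l \in S, rk l = nxt r & cov la lb l i j].
      by apply: block_cov tc' _; move: en; rewrite /exits; lia.
    by exists l; rewrite lE -(rep_next nsr).
  apply: IH lt tc' _ _ _ => //; first exact: tangled_block tn.
  - by rewrite -(rep_next nsr).
  - by move: lr; rewrite (lamP ir) tp (negbTE en) addn0.
  - by left; apply: on_chain_next.
have ts := stP vN; apply: (key (st v)) => //; first exact: touches_block ts.
  by apply: touches_sub ts _ _; lia.
have [e|e] := boolP (exits v (st v)); [by right|left; exists 0; split=> // m].
by rewrite leqn0 => /eqP ->.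
Qed.

End Dependency.

(** Recursion along the pointers, used for [lam] and for [rep]; as they increase ranks bounded by
    [M], fuel [M - r] is enough. *)
Lemma chain_recursion (T : Type) (M : nat) (good : nat -> Prop)
    (nxt : nat -> nat) (g : nat -> T -> T) (d : nat -> T) :
  (forall r, good r -> r < nxt r) -> (forall r, good r -> r < M) ->
  exists F : nat -> T, forall r,
    (good r -> F r = g r (F (nxt r))) /\ (~ good r -> F r = d r).
Proof.
move=> nxt_lt goodM.
pose fix F (n r : nat) {struct n} : T := if n is n'.+1 then
  if `[< good r >] then g r (F n' (nxt r)) else d r else d r.
have F_bad n r : ~ good r -> F n r = d r.
  by case: n => //= n nr; rewrite asboolF.
have F_stable n n' r : M - r <= n -> M - r <= n' -> F n r = F n' r.
  move=> Mn Mn'; have [gr|nr] := EM (good r); last by rewrite !F_bad.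
  have := goodM r gr; elim: n n' r gr Mn Mn' => [|n IH] [|n'] r gr Mn Mn' rM; try lia.
  rewrite /= asboolT //; congr g; have rn := nxt_lt r gr.
  have [gn|nn] := EM (good (nxt r)); last by rewrite !F_bad.
  by apply: IH => //; rewrite ?goodM //; lia.
exists (fun r => F (M - r) r) => r; split=> [gr|]; last exact: F_bad.
have rM := goodM r gr; have rn := nxt_lt r gr.
case E : (M - r) => [|m] /=; first lia.
by rewrite asboolT //; congr g; apply: F_stable; lia.
Qed.

(** * Thin classes of links between positions *)

Definition nested_or_disjoint (i j i' j' : nat) : Prop :=
  [\/ j' < i, j < i', i' <= i /\ j <= j' | i <= i' /\ j' <= j].

(* [B] holds of the hulls of the blocks that avoid the root. *)
Lemma thin_classes (L : finType) (la lb : L -> nat) (N : nat) (S : {set L})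
    (dl dr : nat -> nat) (k : nat) :
  (forall l, l \in S -> la l < lb l <= N) ->
  (forall i j, 0 < i -> i <= j -> j <= N ->
     exists2 l, l \in S & cov la lb l i j) ->
  (forall v, 0 < v <= N -> 0 < dl v <= v /\ v <= dr v <= N) ->
  (forall v w, 0 < v <= N -> 0 < w <= N ->
     dl w <= v <= dr w -> dl v <= w <= dr v -> v = w) ->
  (forall i j, 0 < i -> i <= j -> j <= N ->
     exists v, [/\ i <= v <= j, dl v <= i & j <= dr v]) ->
  exists (B : nat -> nat -> Prop) (label : nat -> nat),
    [/\ forall i j, B i j -> 0 < i <= j /\ j <= N,
        forall i j i' j', B i j -> B i' j' -> nested_or_disjoint i j i' j' &
        forall c, c < k -> exists cls : L -> nat,
          (forall z i j, i <= j ->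
             (forall i' j', B i' j' -> nested_or_disjoint i j i' j') ->
             #|[set l in S | (cls l == z) && cov la lb l i j]| <= 4 * k) /\
          (forall v, 0 < v <= N -> label v %% k <> c ->
             exists z, forall i j, i <= v <= j -> dl v <= i -> j <= dr v ->
               exists l, [/\ l \in S, cls l = z & cov la lb l i j])].
Proof.
move=> link_le covered d_bounds d_anti d_top.
have link_lt l : l \in S -> la l < lb l by move=> /link_le; lia.
have [rk [lo [hi fe]]] := festoons_exist link_le.
pose inn := inner S rk lo; pose tang := tangled la lb S rk lo hi.
have /choice[top topP] : forall r, exists v, inn r ->
    lo r <= v <= hi r /\ ~~ exits lo hi dl dr v r.
  move=> r.
  have [ir|nr] := EM (inn r); last by exists 0.
  have := block_hull fe ir.1 => hr; have [|||v [vr lv rv]] := d_top (lo r) (hi r).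
  - exact: ir.2.
  - lia.
  - lia.
  by exists v => _; rewrite /exits lv rv.
have /choice[nxt nxtP] : forall r, exists n, inn r -> tang r n /\
   ((exits lo hi dl dr (top r) n /\
     forall s, tang r s -> exits lo hi dl dr (top r) s -> n <= s) \/
    (forall s, tang r s -> ~~ exits lo hi dl dr (top r) s /\ s <= n)).
  move=> r.
  have [ir|nr] := EM (inn r); last by exists 0.
  have [s0 rs0] := tangled_exists fe link_lt covered ir.
  have [[s [rs es]]|nex] := EM (exists s, tang r s /\ exits lo hi dl dr (top r) s).
    have [n [[rn en] nmin]] := @nat_min_exists
      (fun s => tang r s /\ exits lo hi dl dr (top r) s) s (conj rs es).
    by exists n => _; split=> //; left; split=> // t rt et; apply: nmin.
  have [|n [rn nmax]] := @nat_max_exists (tang r) #|S| s0 rs0.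
    by move=> s /tangled_block/(block_lt fe)/ltnW.
  exists n => _; split=> //; right=> s rs; split; last exact: nmax.
  by apply/negP => es; apply: nex; exists s.
have /choice[st stP] : forall v, exists r, 0 < v <= N ->
    touches la lb S rk r v v.
  move=> v.
  have [vN|nv] := boolP (0 < v <= N); last by exists 0 => vN; case/negP: nv.
  have [|||l lS lc] := covered v v; try lia.
  by exists (rk l) => _; exists l; split=> //; move: lc; rewrite /cov; lia.
have nxt_lt r : inn r -> r < nxt r by move=> /nxtP[[]].
have inn_lt r : inn r -> r < #|S| by case=> /(block_lt fe).
have [lam lamP] := chain_recursion
  (fun r m => m + exits lo hi dl dr (top r) (nxt r)) (fun=> 0) nxt_lt inn_lt.
(* The label of [v] is the value of [lam] on its whole chain. It does not depend on [c], so [c] can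
   be chosen by cost afterwards. *)
exists (fun i j => exists r, [/\ inn r, i = lo r & j = hi r]), (fun v => lam (st v)).
split.
- by move=> _ _ [r [ir -> ->]]; have := block_hull fe ir.1; have := ir.2; lia.
- move=> _ _ _ _ [r [ir -> ->]] [s [is_ -> ->]]; rewrite /nested_or_disjoint.
  have hr := block_hull fe ir.1.
  have [rs|rs|->] := ltngtP r s; last by constructor 3.
    case: (hull_laminar fe ir.1 is_.1 rs) => ?; first by constructor 2.
      by constructor 1.
    by constructor 3.
  case: (hull_laminar fe is_.1 ir.1 rs) => ?; first by constructor 1.
    by constructor 2.
  by constructor 4.
move=> c ck.
pose stp := stop S rk lo hi dl dr top nxt st lam k c.
have nstp_inn r : ~ stp r -> inn r by case/nonstop.
have [rep repP] := chain_recursion (fun r m => m) id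
  (fun r nr => nxt_lt r (nstp_inn r nr)) (fun r nr => inn_lt r (nstp_inn r nr)).
have rep_stop r : stp r -> rep r = r by move=> sr; apply: (repP r).2.
have rep_next r : ~ stp r -> rep r = rep (nxt r) by exact: (repP r).1.
have lamP' r := (lamP r).1.
exists (rep \o rk); split.
  move=> z i j ij nd; apply: (card_cov_class fe link_lt d_bounds d_anti topP nxtP
    stP lamP' ck rep_stop rep_next z ij) => r ir.
  by apply: nd; exists r.
move=> v vN lv; exists (rep (st v)) => i j vij iv jv.
exact: (class_covers fe link_lt d_bounds d_anti topP nxtP stP lamP' ck rep_next).
Qed.

(** * Cycles and positions *)

(* If the root edge follows the root on the given cycle, reverse the cycle. *)
Lemma rooted_cycle (R : realType) (V E : finType) (I : rootedWRAP R V E) :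
  exists (m : nat) (w : 'I_m.+2 -> V) (e : 'I_m.+2 -> E),
    [/\ bijective w, bijective e,
        forall i, ends I (e i) = [set w i; w (ordS i)],
        w ord0 = root I & e ord_max = root_edge I].
Proof.
have [n [v [e [n1 vbij ebij ve]]]] := ends_cycle I.
case: n n1 v e vbij ebij ve => [|[|m]] // _ v e vbij ebij ve.
have ordSE (i : 'I_m.+2) : ordS i = (i + 1)%R.
  by apply: val_inj; rewrite /= -[in RHS]modnDmr modnDmr addn1 //.
have maxE : ord_max = (-1)%R :> 'I_m.+2 by apply: val_inj; rewrite /= modn_small.
have [e' _ e'K] := ebij; set i0 := e' (root_edge I).
have := root_edgeP I; rewrite -(e'K (root_edge I)) -/i0 ve !inE => /orP[]/eqP rE.
  exists m, (fun i => v (i0 - i)%R), (fun i => e (i0 - i - 1)%R).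
  have bij1 : bijective (fun i : 'I_m.+2 => (i0 - i)%R).
    by exists (fun i => (i0 - i)%R) => i; ring.
  have bij2 : bijective (fun i : 'I_m.+2 => (i0 - i - 1)%R).
    by exists (fun i => (i0 - i - 1)%R) => i; ring.
  split; [exact: bij_comp vbij bij1|exact: bij_comp ebij bij2| | |].
  - by move=> i; rewrite ve !ordSE subrK setUC opprD addrA.
  - by rewrite -[ord0]/(0 : 'I_m.+2)%R subr0.
  - by rewrite maxE opprK addrK e'K.
exists m, (fun i => v (i0 + 1 + i)%R), (fun i => e (i0 + 1 + i)%R).
have bij1 : bijective (fun i : 'I_m.+2 => (i0 + 1 + i)%R).
  by exists (fun i => (i - (i0 + 1))%R) => i; ring.
split; [exact: bij_comp vbij bij1|exact: bij_comp ebij bij1| | |].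
- by move=> i; rewrite ve !ordSE addrA.
- by rewrite -[ord0]/(0 : 'I_m.+2)%R addr0 -ordSE.
- by rewrite maxE addrK e'K.
Qed.

Lemma card_pairI1 (T : finType) (x y : T) (C : {set T}) : x != y ->
  (#|[set x; y] :&: C| == 1) = ((x \in C) != (y \in C)).
Proof.
have card1 z : #|[set z] :&: C| = (z \in C).
  have [zC|zC] := boolP (z \in C); first by rewrite (setIidPl _) ?sub1set ?cards1.
  by rewrite disjoint_setI0 ?cards0 // disjoints1.
move=> xy; rewrite setIUl cardsU !card1.
have -> : [set x] :&: C :&: ([set y] :&: C) = set0.
  by apply/setP => z; rewrite !inE; case: eqVneq => [->|//]; rewrite (negbTE xy) andbF.
by rewrite cards0 subn0; case: (x \in C); case: (y \in C).
Qed.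

(** The extreme true positions [i] and [j] give changes at [i.-1] and [j], and a false position
    between them would give a third change. *)
Lemma card_changes (N : nat) (b : nat -> bool) : b 0 = false ->
  (#|[set g : 'I_N.+1 | b g != b (g.+1 %% N.+1)]| == 2) <->
  exists i j, [/\ 0 < i, i <= j, j <= N & forall g, g <= N -> b g = (i <= g <= j)].
Proof.
move=> b0; set D := [set g | _].
have chg (g : nat) (gN : g < N.+1) : b g != b (g.+1 %% N.+1) -> Ordinal gN \in D.
  by rewrite inE.
split=> [/eqP D2|[i [j [i0 ij jN bE]]]]; last first.
  have iN : i.-1 < N.+1 by lia.
  have jN' : j < N.+1 by lia.
  suff -> : D = [set Ordinal iN; Ordinal jN'].
    by rewrite cards2 -val_eqE /=; have -> : i.-1 != j by lia.
  apply/setP => g; rewrite !inE -!val_eqE /=; have := ltn_ord g => gN.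
  rewrite bE; last lia.
  have [gM|gM] := ltnP g N; last first.
    have -> : g = N :> nat by lia.
    by rewrite modnn b0; lia.
  by rewrite modn_small // bE; lia.
have [g0 g0D] : exists g, g \in D by apply/card_gt0P; rewrite D2.
have [t0 [t0N bt0]] : exists t, t <= N /\ b t.
  move: g0D; rewrite inE; case bg: (b g0) => /= bg'.
    by exists g0; have := ltn_ord g0; split; rewrite ?bg //; lia.
  by exists (g0.+1 %% N.+1); split; [rewrite -ltnS ltn_pmod|case: (b _) bg'].
have [i [[iN bi] imin]] := @nat_min_exists (fun t => t <= N /\ b t) t0 (conj t0N bt0).
have [|j [[jN bj] jmax]] := @nat_max_exists (fun t => t <= N /\ b t) N t0 (conj t0N bt0).
  by move=> t [].
have i0 : 0 < i by case: (i) bi; rewrite ?b0.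
have ij : i <= j by apply: imin.
exists i, j; split=> // g gN; apply/idP/idP => [bg|gij].
  by rewrite imin ?jmax.
apply/negPn/negP => nbg.
have [a [[ia ba] amin]] := @nat_min_exists (fun t => i <= t /\ ~~ b t) g (conj (proj1 (andP gij)) nbg).
have ag := amin g (conj (proj1 (andP gij)) nbg).
have nai : a <> i by move=> e; rewrite e bi in ba.
have naj : a <> j by move=> e; rewrite e bj in ba.
have ba1 : b a.-1.
  apply/negPn/negP => nb; suff : a <= a.-1 by lia.
  by apply: amin; split=> //; lia.
have bi1 : b i.-1 = false.
  apply/negP => nb; suff : i <= i.-1 by lia.
  by apply: imin; split=> //; lia.
have h1 : i.-1 < N.+1 by lia.
have h2 : a.-1 < N.+1 by lia.
have h3 : j < N.+1 by lia.
suff : 2 < #|D| by rewrite D2.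
apply/card_gt2P; exists (Ordinal h1), (Ordinal h2), (Ordinal h3); split; split.
- by apply: chg; rewrite prednK // modn_small // bi bi1.
- apply: chg; rewrite prednK; last lia.
  by rewrite modn_small ?ba1 ?(negbTE ba) //; lia.
- apply: chg; rewrite bj; have [jN'|jN'] := ltnP j N; last first.
    have -> : j = N by lia.
    by rewrite modnn b0.
  rewrite modn_small //; apply/negP => /eqP bj1.
  by have := jmax j.+1 (conj jN' (esym bj1)); lia.
- by rewrite -val_eqE /=; lia.
- by rewrite -val_eqE /=; lia.
- by rewrite -val_eqE /=; lia.
Qed.

(** Edges at the boundary of [C] correspond to changes of membership between cyclically consecutive
    positions, so [card_changes] describes the cuts. The root edge joins the positions [N] and [0],
    so successive positions stay adjacent without it. *)
Lemma positions (R : realType) (V E : finType) (I : rootedWRAP R V E) :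
  exists (N : nat) (p : V -> nat) (q : nat -> V),
    [/\ p (root I) = 0, forall x, p x <= N /\ q (p x) = x,
        forall g, g <= N -> p (q g) = g,
        forall C, C \in cuts I <-> exists i j,
          [/\ 0 < i, i <= j, j <= N & C = [set x | i <= p x <= j]] &
        forall g, g < N -> adj_minus_root_edge I (q g) (q g.+1) /\
                           adj_minus_root_edge I (q g.+1) (q g)].
Proof.
have [m [w [e [wbij [e' eK e'K] we w0 eM]]]] := rooted_cycle I.
have [w' wK w'K] := wbij.
pose p x : nat := w' x; pose q g := w (inord g).
have qK x : q (p x) = x by rewrite /q /p inord_val w'K.
have pK g : g <= m.+1 -> p (q g) = g by move=> gm; rewrite /p /q wK inordK.
have ordSE (i : 'I_m.+2) : ordS i != i.
  apply/eqP => /(congr1 val) /=; have := ltn_ord i => im.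
  have [i1|i1] := ltnP i m.+1; first by rewrite modn_small //; lia.
  have -> : i = m.+1 :> nat by lia.
  by rewrite modnn.
exists m.+1, p, q; split=> //.
- by rewrite /p -w0 wK.
- by move=> x; split=> //; have := ltn_ord (w' x).
- move=> C; rewrite inE; have [rC|rC] /= := boolP (root I \in C).
    split=> // -[i [j [i0 _ _ CE]]]; move: rC.
    by rewrite CE inE /p -w0 wK /=; lia.
  have deltaE : delta (ends I) setT C =
      e @: [set i : 'I_m.+2 | (q i \in C) != (q (i.+1 %% m.+2) \in C)].
    apply/setP => x; rewrite !inE -{1}(e'K x) we /= card_pairI1; last first.
      by rewrite (can_eq wK) eq_sym ordSE.
    have nxtE (i : 'I_m.+2) : w (ordS i) = q (i.+1 %% m.+2).
      by congr w; apply: val_inj; rewrite /= inordK // ltn_pmod.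
    have idE (i : 'I_m.+2) : w i = q i by rewrite /q inord_val.
    rewrite nxtE idE; apply/idP/imsetP => [xC|[i]].
      by exists (e' x); rewrite ?inE ?e'K.
    by rewrite inE => iC ->; rewrite eK.
  rewrite deltaE card_imset; last exact: can_inj eK.
  rewrite (@card_changes m.+1 (fun g => q g \in C)); last first.
    by apply/negbTE; move: rC; rewrite -w0 -(qK (w ord0)) /p wK.
  split=> -[i [j [i0 ij jN bE]]]; exists i, j; split=> //.
    by apply/setP => x; rewrite inE -bE ?qK // /p; have := ltn_ord (w' x); lia.
  by move=> g gN; rewrite bE inE pK.
move=> g gN; suff adj : ends I (e (inord g)) = [set q g; q g.+1].
  have neq : e (inord g) != root_edge I.
    rewrite -eM (can_eq eK) -val_eqE /= inordK; lia.
  by split; apply/existsP; exists (e (inord g)); rewrite neq adj // setUC eqxx.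
rewrite we /q; congr [set _; w _]; apply: val_inj => /=.
by rewrite !inordK ?modn_small; lia.
Qed.

(** * Decomposition *)

Lemma path_mkseq (T : Type) (e : rel T) (f : nat -> T) (d : nat) :
  (forall k, k < d -> e (f k) (f k.+1)) ->
  path e (f 0) (mkseq (f \o succn) d) /\ last (f 0) (mkseq (f \o succn) d) = f d.
Proof.
elim: d => [|d IH] ef //; have [k kd|pf lf] := IH; first by apply: ef; lia.
by rewrite mkseqS rcons_path last_rcons pf lf ef.
Qed.

Lemma on_path_mkseq (R : realType) (V E : finType) (I : rootedWRAP R V E)
    (f : nat -> V) (d : nat) : 0 < d ->
  (forall k, k < d -> adj_minus_root_edge I (f k) (f k.+1)) ->
  (forall k k', k <= d -> k' <= d -> f k = f k' -> k = k') ->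
  on_path I (f 0) (f d) (f 1).
Proof.
move=> d0 ef finj; have [pf lf] := path_mkseq ef.
exists (mkseq (f \o succn) d); split=> //; last first.
  by rewrite inE; apply/orP; right; apply/mapP; exists 0; rewrite // mem_iota.
have -> : f 0 :: mkseq (f \o succn) d = mkseq f d.+1.
  by rewrite /mkseq /= (iotaDl 1 0) -map_comp.
rewrite map_inj_in_uniq ?iota_uniq // => a b; rewrite !mem_iota => a_d b_d.
by apply: finj; lia.
Qed.

(** * Cuts and directed links in terms of positions *)

Section Positions.
Variables (R : realType) (V E : finType) (I : rootedWRAP R V E).
Variables (N : nat) (p : V -> nat) (q : nat -> V).
Hypothesis pP : forall x, p x <= N /\ q (p x) = x.
Hypothesis qK : forall g, g <= N -> p (q g) = g.
Hypothesis cutsP : forall C, C \in cuts I <-> exists i j,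
  [/\ 0 < i, i <= j, j <= N & C = [set x | i <= p x <= j]].
Hypothesis adjP : forall g, g < N -> adj_minus_root_edge I (q g) (q g.+1) /\
  adj_minus_root_edge I (q g.+1) (q g).

Definition itv (i j : nat) : {set V} := [set x | i <= p x <= j].

Lemma itv_cut i j : 0 < i -> i <= j -> j <= N -> itv i j \in cuts I.
Proof. by move=> ? ? ?; apply/cutsP; exists i, j. Qed.

Lemma laminar_itv i j i' j' : i <= j <= N -> i' <= j' <= N ->
  [|| [disjoint itv i j & itv i' j'], itv i j \subset itv i' j'
    | itv i' j' \subset itv i j] <-> nested_or_disjoint i j i' j'.
Proof.
move=> ijN ijN'; split; last first.
  case=> nd; apply/or3P; [constructor 1|constructor 1|constructor 2|constructor 3].
  - by apply/pred0P => x; rewrite /= !inE; lia.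
  - by apply/pred0P => x; rewrite /= !inE; lia.
  - by apply/subsetP => x; rewrite !inE; lia.
  - by apply/subsetP => x; rewrite !inE; lia.
have mem a b g : g <= N -> (q g \in itv a b) = (a <= g <= b).
  by move=> gN; rewrite inE qK.
case/or3P => [/pred0P dis|/subsetP sub|/subsetP sub].
- have mN : maxn i i' <= N by lia.
  have := dis (q (maxn i i')); rewrite /= !mem // => nb.
  have [lt|le] := ltnP j' i; [by constructor 1|constructor 2].
  by clear dis mem; lia.
- by constructor 3; have := sub (q i); have := sub (q j); rewrite !mem; lia.
- by constructor 4; have := sub (q i'); have := sub (q j'); rewrite !mem; lia.
Qed.

Lemma position_inj x y : p x = p y -> x = y.
Proof. by move=> xy; rewrite -(pP x).2 xy (pP y).2. Qed.

(** The tail moves one step towards the head; an interval containing the new tail but not the old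
    one starts next to the old one. *)
Lemma shortening_next x y : p x != p y ->
  ~~ ((p x).+1 == p y) && ~~ ((p y).+1 == p x) ->
  exists s, [/\ shortening I x y s, s != x &
    forall i j, i <= p s <= j -> ~ (i <= p x <= j) -> i <= p y <= j ->
      i = (p x).+1 \/ p x = j.+1].
Proof.
move=> xy nadj; have [xN xE] := pP x; have [yN yE] := pP y.
have [lt_xy|le_yx] := ltnP (p x) (p y).
  exists (q (p x).+1); have ps : p (q (p x).+1) = (p x).+1 by rewrite qK //; lia.
  split; last by move=> i j; rewrite ps; lia.
    split; first by apply/eqP => e; move: ps; rewrite e; lia.
    have := @on_path_mkseq _ _ _ I (fun k => q (p x + k)) (p y - p x).
    rewrite /= addn0 addn1 subnKC ?xE ?yE; last lia.
    apply; first lia.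
    - by move=> k kd; rewrite addnS; apply: (adjP _).1; lia.
    - by move=> k k' kd kd' /(congr1 p); rewrite !qK; lia.
  by apply/eqP => e; move: ps; rewrite e; lia.
exists (q (p x).-1); have ps : p (q (p x).-1) = (p x).-1 by rewrite qK //; lia.
split; last by move=> i j; rewrite ps; lia.
  split; first by apply/eqP => e; move: ps; rewrite e; lia.
  have := @on_path_mkseq _ _ _ I (fun k => q (p x - k)) (p x - p y).
  rewrite /= subn0 subn1 subKn ?xE ?yE; last lia.
  apply; first lia.
  - move=> k kd; have -> : p x - k = (p x - k.+1).+1 by lia.
    by apply: (adjP _).2; lia.
  - by move=> k k' kd kd' /(congr1 p); rewrite !qK; lia.
by apply/eqP => e; move: ps; rewrite e; lia.
Qed.

Lemma covers_itv (f : dlink V) i j :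
  reflect (enters (fun f : dlink V => p (tail f)) (fun f : dlink V => p (head f)) f i j)
          (covers f (itv i j)).
Proof.
rewrite /covers !inE /enters; apply: (iffP andP) => -[? ?]; split=> //.
  exact/negP.
exact/negP.
Qed.

Section Solution.
Variable F : {set dlink V}.
Hypothesis solF : is_directed_solution I F.
Hypothesis nsF : non_shortenable I F.

Let t (f : dlink V) := p (tail f).
Let h (f : dlink V) := p (head f).

Lemma cut_entered_itv i j : 0 < i -> i <= j -> j <= N ->
  exists2 f, f \in F & enters t h f i j.
Proof.
move=> i0 ij jN; have [f fF /covers_itv fC] := solF (itv_cut i0 ij jN).
by exists f.
Qed.

Lemma uncovered (F' : {set dlink V}) : ~ is_directed_solution I F' ->
  exists i j, [/\ 0 < i, i <= j, j <= N & forall f, f \in F' -> ~ enters t h f i j].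
Proof.
move=> nF'; apply: contrapT => nex; apply: nF' => C /cutsP[i [j [i0 ij jN ->]]].
apply: contrapT => nf; apply: nex; exists i, j; split=> // f fF' /covers_itv fC.
by apply: nf; exists f.
Qed.

(** Deleting [f] leaves a cut that only [f] enters. It starts next to the tail if tail and head are
    adjacent; otherwise shortening [f] by one step leaves uncovered a cut that contains the new tail
    but not the old one. *)
Lemma private_cut_itv f : f \in F -> exists i j,
  [/\ 0 < i, i <= h f <= j, j <= N, (t f).+1 = i \/ t f = j.+1 &
      forall g, g \in F -> enters t h g i j -> g = f].
Proof.
move=> fF.
have only i j : 0 < i -> i <= j -> j <= N ->
    (forall g, g \in F :\ f -> ~ enters t h g i j) ->
    enters t h f i j /\ forall g, g \in F -> enters t h g i j -> g = f.
  move=> i0 ij jN nF; have uniq_f g : g \in F -> enters t h g i j -> g = f.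
    by move=> gF eg; apply: contrapT => /eqP gf; apply: (nF g) => //; rewrite !inE gf.
  split=> //; have [g gF eg] := cut_entered_itv i0 ij jN.
  by rewrite -(uniq_f g gF eg).
have [i [j [i0 ij jN nF]]] := uncovered (nsF.1 f fF).
have [[hf tf] uf] := only i j i0 ij jN nF.
have [adj|nadj] := boolP (((t f).+1 == h f) || ((h f).+1 == t f)).
  by exists i, j; split=> //; lia.
have [||s [sh sx sP]] := @shortening_next (tail f) (head f).
- by apply/eqP; rewrite -/(t f) -/(h f); lia.
- by rewrite -negb_or.
have [i' [j' [i'0 ij' j'N nF']]] := uncovered (nsF.2 f s fF sh sx).
have [|[hf' tf'] uf'] := only i' j' i'0 ij' j'N.
  by move=> g gF; apply: nF'; rewrite in_setU1 gF orbT.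
have sij : i' <= p s <= j'.
  apply/negPn/negP => ns; apply: (nF' (origin f, (s, head f))).
    by rewrite in_setU1 eqxx.
  by split=> //; apply/negP.
exists i', j'; split=> //.
by case: (sP i' j' sij tf' hf') => e; [left; rewrite e|right].
Qed.

End Solution.

Hypothesis p_root : p (root I) = 0.

(** The path to the tail of [f] never enters [C]. It cannot enter [a .. b] either, since it would do
    so at [v], which lies in [C]; hence [f] itself enters [a .. b]. *)
Lemma responsible_head (F : {set dlink V}) f (C : {set V}) (v a b : nat) :
  (forall g, g \in F -> enters (fun g : dlink V => p (tail g))
     (fun g : dlink V => p (head g)) g a b -> p (head g) = v) ->
  q v \in C -> C \subset itv a b -> 0 < a -> f \in F ->
  responsible I F f C -> p (head f) = v.
Proof.
move=> rooted vC /subsetP Cab a0 fF [_ /andP[hC tC] [s [sF chain lst _] avoid]].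
have stay g : g \in F -> tail g \notin itv a b -> head g \in itv a b ->
    p (head g) = v.
  move=> gF tg hg; apply: rooted => //; split; first by move: hg; rewrite inE.
  by apply/negP; move: tg; rewrite inE.
have key : forall s x, {subset s <= F} ->
    map (@tail V) s = belast x (map (@head V) s) ->
    (forall g, g \in s -> ~~ covers g C) -> x \notin itv a b -> x \notin C ->
    last x (map (@head V) s) \notin itv a b.
  elim=> [|g s' IH] x //= sF' [tg ch] av xab xC.
  have gF : g \in F by apply: sF'; rewrite inE eqxx.
  have hgC : head g \notin C.
    by have := av g; rewrite inE eqxx => /(_ isT); rewrite /covers tg xC andbT.
  apply: IH => //.
  - by move=> g' g's; apply: sF'; rewrite inE g's orbT.
  - by move=> g' g's; apply: av; rewrite inE g's orbT.
  - apply/negP => hg; case/negP: hgC.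
    by rewrite -(pP (head g)).2 (stay g gF) // tg.
have rab : root I \notin itv a b by rewrite inE p_root; lia.
apply: stay => //; last exact: Cab.
by rewrite -lst; apply: key => //; apply/negP => /Cab; rewrite (negbTE rab).
Qed.

End Positions.

Lemma cheap_class (R : realType) (T : finType) (F : {set T}) (x : T -> R)
    (label : T -> nat) (k : nat) : 0 < k ->
  exists2 c, c < k &
    (k%:R * (\sum_(f in F | (label f %% k == c)%N) x f) <= \sum_(f in F) x f)%R.
Proof.
case: k => // k _; set X := (\sum_(f in F) x f)%R; apply: contrapT => nex.
pose y (c : 'I_k.+1) := (\sum_(f in F | (label f %% k.+1 == c)%N) x f)%R.
have Xy c : (X < k.+1%:R * y c)%R.
  by rewrite ltNge; apply/negP => le; apply: nex; exists c.
have XE : X = (\sum_c y c)%R.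
  rewrite /X (partition_big (fun f => inord (label f %% k.+1)%N : 'I_k.+1) xpredT) //=.
  apply: eq_bigr => c _; apply: eq_bigl => f.
  by rewrite -val_eqE /= inordK // ltn_pmod.
have : (\sum_(c < k.+1) X < \sum_(c < k.+1) k.+1%:R * y c)%R.
  by apply: Num.Theory.ltr_sum => //; apply/hasP; exists ord0; rewrite ?mem_index_enum.
by rewrite -mulr_sumr -XE sumr_const card_ord mulr_natl ltxx.
Qed.

Theorem theorem15 (R : realType) (V E : finType) (I : rootedWRAP R V E)
    (S : {set {set V}}) (F0 : {set dlink V}) :
  is_solution I S ->
  (forall f : dlink V, f \in F0 -> is_shadow I f) ->
  is_directed_solution I F0 ->
  non_shortenable I F0 ->
  forall eps : R, (0 < eps)%R ->
  exists (P : {set {set {set V}}}) (Rl : {set dlink V}),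
    [/\ partition P S,
        forall K : {set {set V}}, K \in P ->
          thin I (4 * absz (Num.ceil (1 / eps)%R)) K,
        Rl \subset F0,
        forall f : dlink V, f \in F0 :\: Rl ->
          exists2 K : {set {set V}}, K \in P & Drop I F0 K f &
        (dcost I Rl <= eps * dcost I F0)%R].
Proof.
move=> [SL covS] shF solF nsF eps eps0.
have [N [p [q [p_root pP qK cutsP adjP]]]] := positions I.
pose t (f : dlink V) := p (tail f); pose h (f : dlink V) := p (head f).
have entF := cut_entered_itv cutsP solF.
have prvF := private_cut_itv pP qK cutsP adjP solF nsF.
have tN f : f \in F0 -> t f <= N by move=> _; apply: (pP _).1.
have /choice[d dP] : forall v, exists d : nat * nat, 0 < v <= N ->
    rooted F0 t h N v d.1 d.2 /\
    forall i j, rooted F0 t h N v i j -> d.1 <= i /\ j <= d.2.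
  move=> v; have [vN|nv] := boolP (0 < v <= N); last by exists (0, 0).
  by have [dv dvP] := territory_exists entF prvF vN; exists dv.
pose dl v := (d v).1; pose dr v := (d v).2.
have d_bounds v : 0 < v <= N -> 0 < dl v <= v /\ v <= dr v <= N.
  by move=> /dP[[? ? ? _] _]; rewrite /dl /dr; lia.
have d_anti := territory_anti entF (dl := dl) (dr := dr) dP.
have d_top := interval_top tN entF prvF (dl := dl) (dr := dr) dP.
have /choice[ab abP] : forall l, exists ab : nat * nat, l \in S ->
    ab.1 < ab.2 <= N /\ l = [set q ab.1; q ab.2].
  move=> l; have [lS|nl] := boolP (l \in S); last by exists (0, 0).
  have lL := subsetP SL l lS; have l2 := links_card2 lL; move/eqP: l2 => /cards2P[x [y [xy lE]]].
  have [xN xE] := pP x; have [yN yE] := pP y.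
  have pxy : p x <> p y by move=> /(position_inj pP) e; rewrite e eqxx in xy.
  have [lt|le] := ltnP (p x) (p y).
    by exists (p x, p y) => _; rewrite /= xE yE; split=> //; lia.
  by exists (p y, p x) => _; rewrite /= xE yE setUC; split=> //; lia.
pose la l := (ab l).1; pose lb l := (ab l).2.
have link_le l : l \in S -> la l < lb l <= N by move=> /abP[].
have deltaE (K : {set {set V}}) l i j : K \subset S ->
    (l \in delta_links K (itv p i j)) = (l \in K) && cov la lb l i j.
  move=> /subsetP KS; rewrite inE; have [lK|//] /= := boolP (l \in K).
  have [lab lE] := abP l (KS l lK).
  have lN : la l <= N by rewrite /la; lia.
  have lN' : lb l <= N by rewrite /lb; lia.
  rewrite {1}lE card_pairI1; last by apply/eqP => /(congr1 p); rewrite !qK //; lia.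
  by rewrite !inE !qK.
have covered i j : 0 < i -> i <= j -> j <= N -> exists2 l, l \in S & cov la lb l i j.
  move=> i0 ij jN; have /set0Pn[l] := covS _ (itv_cut cutsP i0 ij jN).
  by rewrite deltaE // => /andP[]; exists l.
set k := absz _.
have k1 : (1 <= eps * k%:R)%R.
  have inv_le : (1 / eps <= (Num.ceil (1 / eps))%:~R :> R)%R by rewrite -ceil_le_int.
  have -> : (k%:R = (Num.ceil (1 / eps))%:~R :> R)%R.
    rewrite natr_absz ger0_norm // -(ler_int R).
    by apply: le_trans inv_le; rewrite divr_ge0 // ltW.
  by rewrite mulrC -ler_pdivrMr.
have k0 : 0 < k.
  by rewrite lt0n; apply/eqP => e; move: k1; rewrite e mulr0 ler10.
have [B [label [Bitv Blam clsP]]] := thin_classes k link_le covered d_bounds d_anti d_top.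
have [c ck cheap] := cheap_class F0 (fun f => cost I (origin f)) (fun f => label (h f)) k0.
have [cls [thin_cls cov_cls]] := clsP c ck.
exists (preim_partition cls S), [set f in F0 | label (h f) %% k == c].
split.
- exact: preim_partitionP.
- move=> K /imsetP[l0 l0S KE].
  have KS : K \subset S by rewrite KE; apply/subsetP => l; rewrite inE => /andP[].
  split; first exact: subset_trans KS SL.
  (* The hulls avoiding the root form a laminar family of cuts. Every member of a maximal laminar
     family containing them is laminar with all of them, as the bound on classes demands. *)
  pose B0 := [set C : {set V} | `[< exists i j, B i j /\ C = itv p i j >]].
  have B0lam : laminar B0 && (B0 \subset cuts I).
    apply/andP; split; last first.
      apply/subsetP => C; rewrite inE => /asboolP[i [j [/Bitv Bij ->]]].
      by apply: (itv_cut cutsP); lia.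
    apply/forallP => C; apply/implyP; rewrite inE => /asboolP[i [j [Bij ->]]].
    apply/forallP => C'; apply/implyP; rewrite inE => /asboolP[i' [j' [Bij' ->]]].
    have [ij jN] := Bitv _ _ Bij; have [ij' jN'] := Bitv _ _ Bij'.
    by apply/(laminar_itv qK); [lia|lia|apply: Blam].
  have [F maxF /subsetP B0F] := maxset_exists (P := fun F' => laminar F' && (F' \subset cuts I)) B0lam.
  exists F => // C CF.
  have /maxsetP[/andP[/forall_inP Flam /subsetP Fcuts] _] := maxF.
  have /cutsP[i [j [i0 ij jN CE]]] := Fcuts C CF.
  have nd i' j' : B i' j' -> nested_or_disjoint i j i' j'.
    move=> Bij'; have [ij' jN'] := Bitv _ _ Bij'.
    have C'F : itv p i' j' \in F by apply: B0F; rewrite inE; apply/asboolP; exists i', j'.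
    have /forall_inP/(_ _ C'F) := Flam C CF; rewrite CE -/(itv p i j).
    by move/(laminar_itv qK); apply; [rewrite ij jN|case/andP: ij' => _ ->].
  apply: leq_trans (thin_cls (cls l0) i j ij nd).
  apply/subset_leq_card/subsetP => l; rewrite CE -/(itv p i j) deltaE // => /andP[lK lc].
  by move: lK; rewrite KE !inE => /andP[-> /eqP ->]; rewrite eqxx.
- by apply/subsetP => f; rewrite inE => /andP[].
- move=> f; rewrite !inE => /andP[nR fF]; rewrite fF /= in nR.
  have hN : 0 < h f <= N.
    by have [i [j [? ? ? _ _]]] := prvF f fF; rewrite /h; lia.
  have [z zP] := cov_cls (h f) hN (elimN eqP nR).
  have := d_bounds _ hN => hd.
  (* The link found for the single vertex [h f] shows that the class is non-empty, hence a member of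
     the partition. *)
  have [|||l0 [l0S l0z _]] := zP (h f) (h f); try lia.
  exists [set l in S | cls l0 == cls l]; first by apply/imsetP; exists l0.
  split=> // C resp; have [/cutsP[i [j [i0 ij jN CE]]] _ _] := resp.
  (* A cut for which [f] is responsible has its top at the head of [f]. *)
  have [w [wij lw rw]] := d_top i j i0 ij jN.
  have wN : 0 < w <= N by lia.
  have hw : h f = w.
    apply: (responsible_head pP p_root (a := dl w) (b := dr w) _ _ _ _ fF resp).
    - by have [[_ _ _ ew] _] := dP w wN.
    - by rewrite CE inE qK //; lia.
    - by apply/subsetP => x; rewrite CE !inE; lia.
    - by have := d_bounds w wN; lia.
  have [|||l [lS lz lc]] := zP i j; rewrite ?hw //.
  apply/set0Pn; exists l; rewrite CE -/(itv p i j) deltaE.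
    by rewrite inE lS l0z lz eqxx.
  by apply/subsetP => l'; rewrite inE => /andP[].
- have cost0 f : f \in F0 -> (0 <= cost I (origin f))%R.
    by move=> /shF[oL _]; apply: cost_ge0.
  set Rl := [set f in F0 | _].
  have dE : dcost I Rl = (\sum_(f in F0 | (label (h f) %% k == c)%N) cost I (origin f))%R.
    by apply: eq_bigl => f; rewrite inE.
  have d0 : (0 <= dcost I Rl)%R by rewrite dE; apply: sumr_ge0 => f /andP[/cost0].
  rewrite -dE in cheap.
  apply: (@le_trans _ _ (eps * (k%:R * dcost I Rl))%R).
    by rewrite mulrA ler_peMl.
  by rewrite ler_pM2l.
Qed.
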